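(* Let $n\ge 1$ and let $\tau\in S_n$ have runs (maximal increasing contiguous segments), read from left to right, of lengths $\rho_k,\dots,\rho_1,\rho_0$ (so $\rho_0$ is the length of the last run and $\tau$ has $k+1$ runs). Let $0\le l\le k$. Then $$\sum_{\substack{Pr\in \mathcal{P}ref_n\\ \operatorname{diagword}(Pr)=\tau\\ l(Pr)=l}} t^{\operatorname{area}(Pr)}q^{\operatorname{dinv}(Pr)} = t^{\operatorname{maj}(\tau)}\, q^{\rho_0+\rho_1+\dots+\rho_{l-1}}\prod_{c=1}^n [w^{(l)}(c)]_q ,$$ where $w^{(l)}(c)$ are the $l$-schedule numbers of $\tau$ defined below.
   Context: A preference function on $n$ cars is a map $f:[n]\to[n]$; $\mathcal{P}ref_n$ is the set of all $n^n$ of them. Each is drawn as a labeled lattice path in the $n\times n$ grid: for $j=1,\dots,n$ in turn, the cars $i\in f^{-1}(j)$ are written in column $j$ (the unit cells with lower-left corner $(j-1,y)$), in increasing order from bottom to top, occupying the lowest rows not yet used; each row contains exactly one car. A car whose cell has lower-left corner $(x,y)$ is said to lie in diagonal $y-x$ (the $k$-th diagonal is the line $y=x+k$). The deviation $l(Pr)$ is the maximum of $-(\text{diagonal of }c)$ over all cars $c$ (this is always $\ge 0$). $\operatorname{area}(Pr)=\sum_{\text{cars } c}(d(c)+l(Pr))$, where $d(c)$ is the diagonal of $c$. $\operatorname{dinv}(Pr)$ is the sum of: the number of primary dinvs (pairs of cars in the same diagonal such that the car further left is smaller), the number of secondary dinvs (pairs of cars $b<a$ with $a$ in diagonal $m+1$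 and $b$ in diagonal $m$ for some $m$, and $b$ in a column strictly to the right of $a$), and the tertiary dinv (the number of cars in negative diagonals). The diagonal word $\operatorname{diagword}(Pr)\in S_n$ lists the cars of each nonempty diagonal in increasing order, the diagonals taken from highest to lowest. For a permutation $\tau$, $\operatorname{maj}(\tau)$ is the sum of the positions $i$ with $\tau_i>\tau_{i+1}$; $[m]_q=1+q+\dots+q^{m-1}$. $l$-schedule numbers: let $l\ge0$ and let $\tau$ have at least $l+1$ runs. For $1\le c\le n$: if $c$ lies in one of the last $l$ runs of $\tau$, $w^{(l)}(c)$ is the number of elements smaller than $c$ in its own run plus the number of elements larger than $c$ in the previous run; if $c$ lies in the $(l+1)$-st run from the end, $w^{(l)}(c)$ is the number of elements of that run weakly to the right of $c$ (counting $c$ itself); otherwise $w^{(l)}(c)$ is the number of elements larger than $c$ in its own run plus the number of elements smaller than $c$ in the next run. (Example: for $\tau=2\,3\,1\,4\,5$, $w^{(1)}(3)=1$, $w^{(1)}(2)=2$, $w^{(1)}(1)=2$, $w^{(1)}(4)=1$, $w^{(1)}(5)=2$.) *)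

(* Defs.v *)
From mathcomp Require Import all_boot all_order all_algebra all_fingroup.
Set Implicit Arguments. Unset Strict Implicit. Unset Printing Implicit Defensive.
Import GRing.Theory Num.Theory.

(* Cars 1..n are represented by i : 'I_n (car i.+1); columns 1..n by 'I_n
   (column j.+1, whose cells have lower-left x-coordinate j). *)
Definition prefn (n : nat) := {ffun 'I_n -> 'I_n}.

Section PrefDefs.
Variable n : nat.
Variable f : prefn n.

(* row (y-coordinate of the lower-left corner) of car i: cars in earlier
   columns, plus smaller cars in the same column. *)
Definition prow (i : 'I_n) : nat :=
  #|[set j : 'I_n | f j < f i]| + #|[set j : 'I_n | (f j == f i) && (j < i)]|.

Definition pdiag (i : 'I_n) : int := ((prow i)%:Z - (f i)%:Z)%R.

(* deviation: max over cars of -(diagonal); always >= 0, so computed in nat *)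
Definition pdev : nat := \max_(i : 'I_n) (f i - prow i)%N.

(* area = sum_c (d(c) + l); each summand is >= 0 by definition of l *)
Definition parea : nat := \sum_(i : 'I_n) (prow i + pdev - f i)%N.

Definition pdinv_primary : nat :=
  #|[set p : 'I_n * 'I_n |
      [&& pdiag p.1 == pdiag p.2, f p.1 < f p.2 & p.1 < p.2]]|.

Definition pdinv_secondary : nat :=
  #|[set p : 'I_n * 'I_n |
      [&& p.2 < p.1, pdiag p.1 == (pdiag p.2 + 1)%R & f p.1 < f p.2]]|.

Definition pdinv_tertiary : nat := #|[set c : 'I_n | (pdiag c < 0)%R]|.

Definition pdinv : nat := pdinv_primary + pdinv_secondary + pdinv_tertiary.

(* diagonals listed from n-1 down to -(n-1) (all diagonals that can occur);
   cars of each diagonal in increasing order *)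
Definition pdiagword : seq 'I_n :=
  flatten [seq [seq c <- enum 'I_n | pdiag c == k]
          | k <- [seq (n%:Z - 1 - i%:Z)%R | i <- iota 0 (2 * n - 1)]].

End PrefDefs.

Definition pword n (tau : 'S_n) : seq nat := [seq val (tau i) | i <- enum 'I_n].

Definition maj (s : seq nat) : nat :=
  \sum_(0 <= i < (size s).-1 | nth 0 s i > nth 0 s i.+1) i.+1.

Fixpoint runs (s : seq nat) : seq (seq nat) :=
  match s with
  | [::] => [::]
  | x :: s' =>
      match runs s' with
      | (y :: r) :: rs => if x < y then (x :: y :: r) :: rs
                          else [:: x] :: (y :: r) :: rs
      | _ => [:: [:: x]]
      end
  end.

Definition rrun (s : seq nat) (j : nat) : seq nat := nth [::] (rev (runs s)) j.

Definition rho (s : seq nat) (j : nat) : nat := size (rrun s j).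

Definition sched (l : nat) (s : seq nat) (c : nat) : nat :=
  let j := find (fun r => c \in r) (rev (runs s)) in
  let R := rrun s j in
  if j < l then
    count (fun x => x < c) R + count (fun x => x > c) (rrun s j.+1)
  else if j == l then size R - index c R
  else count (fun x => x > c) R + count (fun x => x < c) (rrun s j.-1).

Definition qint (R : nzRingType) (q : R) (m : nat) : R := (\sum_(i < m) q ^+ i)%R.

(* Main.v *)
Require Import Defs.
From mathcomp Require Import all_boot all_order all_algebra all_fingroup.
From mathcomp Require Import zify ring.
Set Implicit Arguments. Unset Strict Implicit. Unset Printing Implicit Defensive.
Import GRing.Theory Num.Theory Order.TTheory.

(** Reading the cars of a preference function from bottom to top gives a word
    on the cars, and the function is recovered from this word together with the
    diagonal D(c) of each car. The words that occur are those whose first car has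
    D <= 0, whose last car has D >= 0, and in which D goes up by at most 1 from
    one car to the next, the label increasing when D does go up. Hence every
    diagonal between two occupied ones is entered from the one just below by an
    increasing step, which forces a descent of the diagonal word between
    consecutive diagonals: the diagonals are the runs of tau, and D(c) + l is the
    index, from the end, of the run containing c. This fixes the area and the
    tertiary dinv, and turns the primary and secondary dinv into a count of
    ordered pairs in the word.

    The admissible words are built by inserting the cars one at a time: first
    those with D >= 0, reading tau from right to left, then those with D < 0,
    reading tau from left to right. A car c with D(c) >= 0 is inserted just after
    a larger car of its diagonal, or a smaller car of the diagonal below, or at
    the front if D(c) = 0; a car with D(c) < 0 is inserted just before a smaller
    car of its diagonal or a larger car of the diagonal above. There are w(c)
    places, and they contribute 0, 1, ..., w(c) - 1 new pairs, that is, a factor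
    [w(c)]_q. *)

(** * Inserting a letter in a word *)

Section Insertion.
Variables (T : eqType) (e g : rel T) (lok : pred T).

(* [P] constrains the first letter, [lok] the last one, and [E] is the verdict
   on the empty word. Keeping [P] and [E] as parameters lets a word be read as
   the tail of a longer one, and lets the empty word be a case like the others. *)
Fixpoint adm (P : pred T) (E : bool) (w : seq T) : bool :=
  if w is x :: w' then P x && adm (e x) (lok x) w' else E.

Fixpoint ginv (w : seq T) : nat :=
  if w is x :: w' then count (g x) w' + ginv w' else 0.

Definition ins (c : T) (v : seq T) (i : nat) : seq T := take i v ++ c :: drop i v.

Lemma ins0 c v : ins c v 0 = c :: v.
Proof. by rewrite /ins take0 drop0. Qed.

Lemma insS c x v i : ins c (x :: v) i.+1 = x :: ins c v i.
Proof. by []. Qed.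

Lemma perm_ins c v i : perm_eq (ins c v i) (c :: v).
Proof. by rewrite /ins perm_catC /= perm_cons perm_catC cat_take_drop. Qed.

Lemma rem_ins c v i : c \notin v -> rem c (ins c v i) = v.
Proof.
elim: v i => [|x v IHv] [|i] /=; rewrite ?eqxx // inE negb_or.
by move=> /andP[/negbTE + /IHv ->]; rewrite eq_sym => ->.
Qed.

Lemma index_ins c v i : c \notin v -> i <= size v -> index c (ins c v i) = i.
Proof.
elim: v i => [|x v IHv] [|i] //=; rewrite ?eqxx // inE negb_or.
by move=> /andP[/negbTE + /IHv IH] /IH ->; rewrite eq_sym => ->.
Qed.

Lemma ins_index c w : c \in w -> ins c (rem c w) (index c w) = w.
Proof.
elim: w => [|x w IHw] //; rewrite inE eq_sym /=.
by case: eqP => [-> _|_ /IHw Ew]; rewrite ?ins0 ?insS ?Ew.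
Qed.

(** Deleting [c] recovers [v] and the index of [c] recovers [i], so every arrangement of [c :: s]
    arises exactly once. *)
Lemma permutations_ins c s : uniq (c :: s) ->
  perm_eq (permutations (c :: s))
          [seq ins c v i | v <- permutations s, i <- iota 0 (size s).+1].
Proof.
rewrite cons_uniq => /andP[cs us]; apply: uniq_perm; first exact: permutations_uniq.
  apply/allpairs_uniq_dep=> [|v _|]; rewrite ?permutations_uniq ?iota_uniq //.
  move=> _ _ /allpairsPdep[v [i [+ + ->]]] /allpairsPdep[v' [i' [+ + ->]]] /=.
  rewrite !mem_permutations !mem_iota => pv iv pv' iv' Eins.
  have cv : c \notin v by rewrite (perm_mem pv).
  have cv' : c \notin v' by rewrite (perm_mem pv').
  have Ei : i = i'.
    rewrite -(index_ins (v := v) (c := c) (i := i)) // ?Eins ?index_ins //.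
      by rewrite (perm_size pv').
    by rewrite (perm_size pv).
  by rewrite -Ei -(rem_ins i cv) Eins rem_ins.
move=> w; rewrite mem_permutations; apply/idP/allpairsP => [pw|[[v i]]].
  have cw : c \in w by rewrite (perm_mem pw) mem_head.
  exists (rem c w, index c w); rewrite mem_permutations mem_iota ins_index //.
  have := perm_size pw => /= <-; rewrite index_mem; split=> //.
  by rewrite -(perm_cons c) -(permPr pw) perm_sym perm_to_rem.
case; rewrite mem_permutations => pv _ ->.
by rewrite (permPl (perm_ins _ _ _)) perm_cons.
Qed.

Lemma count_ins (a : pred T) c v i : count a (ins c v i) = a c + count a v.
Proof. by rewrite (seq.permP (perm_ins c v i)). Qed.

Local Open Scope ring_scope.
Variables (R : comNzRingType) (q : R).

Lemma qint0 : qint q 0 = 0.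
Proof. by rewrite /qint big_ord0. Qed.

Lemma qintS m : qint q m.+1 = qint q m + q ^+ m.
Proof. by rewrite /qint big_ord_recr. Qed.

Lemma qintSl m : qint q m.+1 = 1 + q * qint q m.
Proof.
rewrite /qint big_ord_recl expr0 big_distrr /=; congr (_ + _).
by apply: eq_bigr => i _; rewrite exprS.
Qed.

Lemma qint1 : qint q 1 = 1.
Proof. by rewrite qintS qint0 add0r. Qed.

(** Admissibility enters as a factor 0 or 1, so that sums run over all permutations and the weight
    splits letter by letter. *)
Definition wt P E w : R := (adm P E w)%:R * q ^+ ginv w.

Lemma wt_cons P E x w :
  wt P E (x :: w) = (P x)%:R * q ^+ count (g x) w * wt (e x) (lok x) w.
Proof.
rewrite /wt /=; case: (P x) => /=; last by rewrite !mul0r.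
by rewrite exprD mul1r; ring.
Qed.

(* The places for [c] are those after a letter [p] with [e p c] (or at the front,
   if [P c]); the attacks created are the places to the right of the chosen one. *)
Lemma sum_ins_after (P : pred T) (E : bool) c (v : seq T) :
  {in v, forall x, e c x} -> lok c ->
  {in v, forall p, e p c -> lok p /\ {in v, forall x, e p x}} ->
  (P c -> E /\ {in v, forall x, P x}) ->
  {in v, forall x, g x c = false /\ g c x = e x c} ->
  \sum_(i < (size v).+1) wt P E (ins c v i)
  = wt P E v * qint q (count (e^~ c) v + P c).
Proof.
move=> + okc; elim: v P E => [|x v IHv] P E ec ee eP eg /=.
  rewrite big_ord1 ins0 /wt /= okc andbT add0n expr0 !mulr1.
  by case: (P c) eP => [[]// -> _|_]; rewrite ?qint1 ?qint0 ?mulr1 ?mulr0.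
have subv : {subset v <= x :: v} by move=> y yv; rewrite inE yv orbT.
have xv : x \in x :: v by rewrite mem_head.
have [gxc gcx] := eg x xv.
have IH := IHv (e x) (lok x).
rewrite big_ord_recl ins0.
under eq_bigr => i _ do rewrite /bump /= insS wt_cons count_ins gxc add0n.
rewrite -big_distrr /= IH; first last.
- by move=> y /subv; apply: eg.
- by move=> /(ee x xv)[-> exv]; split=> // y /subv; apply: exv.
- by move=> p /subv pv /(ee p pv)[-> epv]; split=> // y /subv; apply: epv.
- by move=> y /subv; apply: ec.
rewrite !wt_cons /= gcx ec // mul1r.
have -> : count (g c) v = count (e^~ c) v.
  by apply: eq_in_count => y /subv /eg [].
(* For the tail the front condition is [e x], and its term [e x c] completes the count over
   [x :: v]. The front place, if [P c] allows it, contributes the next power of [q]. *)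
rewrite (addnC (e x c : nat)).
case: (P c) eP => [[]// _ Pv|_] /=; last by rewrite addn0 !mul0r; ring.
by rewrite Pv // addn1 qintS /=; ring.
Qed.

(* Mirror image: the places for [c] are those before a letter [x] with [e c x]
   (or at the end), and the attacks created are the places to the left. *)
Lemma sum_ins_before (P : pred T) (E : bool) c (v : seq T) :
  {in v, forall x, e x c} -> P c ->
  {in v, forall x, e c x -> P x /\ {in v, forall p, e p x}} ->
  (lok c -> E /\ {in v, forall p, lok p}) ->
  {in v, forall x, g c x = false /\ g x c = e c x} ->
  \sum_(i < (size v).+1) wt P E (ins c v i)
  = wt P E v * qint q (count (e c) v + lok c).
Proof.
elim: v P E => [|x v IHv] P E ec Pc ee okc eg /=.
  rewrite big_ord1 ins0 /wt /= Pc add0n expr0 !mulr1.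
  by case: (lok c) okc => [[]// -> _|_]; rewrite ?qint1 ?qint0 ?mulr1 ?mulr0.
have subv : {subset v <= x :: v} by move=> y yv; rewrite inE yv orbT.
have xv : x \in x :: v by rewrite mem_head.
have [gcx gxc] := eg x xv.
have IH := IHv (e x) (lok x).
rewrite big_ord_recl ins0.
under eq_bigr => i _ do rewrite /bump /= insS wt_cons count_ins gxc.
rewrite -big_distrr /= IH; first last.
- by move=> y /subv; apply: eg.
- by move=> /okc[_ oo]; split=> [|y /subv]; apply: oo.
- move=> y /subv yv /(ee y yv)[Py epy]; split; first exact: epy.
  by move=> p /subv; apply: epy.
- exact: ec.
- by move=> y /subv; apply: ec.
rewrite !wt_cons /= gcx Pc add0n !mul1r.
have -> : count (g c) v = 0%N.
  by apply/eqP; rewrite -leqn0 leqNgt -has_count; apply/hasPn => y /subv /eg [->].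
rewrite expr0 mul1r.
(* If [e c x], the front place creates no attack while [x] attacks [c] at every later place, which
   gives 1 + q [k] = [k+1]. Otherwise the front place is lost and [x] never attacks [c]. *)
case: (e c x) (ee x xv) => [[]// Px _|_] /=; last by rewrite !mul0r !add0n; ring.
by rewrite Px add1n addSn qintSl exprS /=; ring.
Qed.

Lemma sum_permutations_cons (P : pred T) (E : bool) c (s : seq T) k : uniq (c :: s) ->
  (forall v, perm_eq v s ->
     \sum_(i < (size v).+1) wt P E (ins c v i) = wt P E v * qint q k) ->
  \sum_(w <- permutations (c :: s)) wt P E w
  = qint q k * \sum_(w <- permutations s) wt P E w.
Proof.
move=> us sum_ins; rewrite (perm_big _ (permutations_ins us)) big_allpairs_dep.
rewrite big_distrr /=; apply: eq_big_seq => v.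
rewrite mem_permutations => pv; rewrite mulrC -sum_ins // (perm_size pv).
by rewrite -(big_mkord xpredT (fun i => wt P E (ins c v i))) /index_iota subn0.
Qed.

End Insertion.

(** * Admissible words of cars *)

Section Words.
Variables (n : nat) (D : 'I_n -> int).
Implicit Types (x y c u v : 'I_n) (w s : seq 'I_n).
Local Open Scope ring_scope.

(* From one row to the next, the diagonal goes up by one exactly when the column
   stays the same, and then the label increases. *)
Definition step x y := (D y <= D x + 1) && ((D y == D x + 1) ==> (x < y)%N).

(* For [x] in a lower row than [y]; comparing rows or columns amounts to the same
   for a pair of cars in the same or in consecutive diagonals. *)
Definition attacks x y :=
  (D x == D y) && (x < y)%N || (D x == D y + 1) && (y < x)%N.

(* The order in which the diagonal word lists the cars. *)
Definition above x y := (D y < D x) || (D x == D y) && (x < y)%N.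

Lemma above_irr : irreflexive above.
Proof. by move=> x; rewrite /above ltxx ltnn andbF. Qed.

Lemma above_trans : transitive above.
Proof. by move=> y x z; rewrite /above; lia. Qed.

Lemma above_uniq s : pairwise above s -> uniq s.
Proof. exact: pairwise_uniq above_irr. Qed.

Definition nneg x := 0 <= D x.
Definition npos x := D x <= 0.

Variables (R : comNzRingType) (q : R).
Let W := wt step attacks nneg q npos true.

(** The head of [s] is inserted last. The factor of a car counts only cars that come after it in
    [s], so later insertions leave it unchanged. *)
Lemma sum_words_nneg s : pairwise above s -> all nneg s ->
  \sum_(w <- permutations s) W w
  = \prod_(c <- s) qint q (count (fun x => above c x && step x c) s + npos c).
Proof.
elim: s => [|c s IHs] us s0; first by rewrite /W /wt /= !big_seq1 big_nil expr0 mulr1.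
rewrite /W (@sum_permutations_cons _ _ _ _ _ q npos true c s
  (count (fun x => above c x && step x c) s + npos c)).
- move: us s0 => /= /andP[/allP cs ps] /andP[c0 s0].
  rewrite -/W IHs // big_cons above_irr /= add0n; congr (_ * _).
  apply: eq_big_seq => x /cs cx /=.
  suff -> : above x c = false by [].
  by move: cx; rewrite /above; lia.
- exact: above_uniq.
move: us s0 => /= /andP[/allP cs _] /andP[c0 /allP s0] v pv.
have {}cs x : x \in v -> above c x by rewrite (perm_mem pv) => /cs.
have {}s0 x : x \in v -> nneg x by rewrite (perm_mem pv) => /s0.
rewrite sum_ins_after //.
- congr (_ * qint q (_ + _)); rewrite -(seq.permP pv).
  by apply: eq_in_count => x /cs ->.
- by move=> x /cs; rewrite /above /step; lia.
- move=> x xv ; have := cs x xv; have := s0 x xv; rewrite /step /above /nneg.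
  move=> x0 cx xc; split => // y yv; have := cs y yv; have := s0 y yv.
  by rewrite /above /nneg; move: x0 cx xc c0; rewrite /nneg; lia.
- rewrite /npos => cle; split=> // y /[dup] /s0 + /cs.
  by rewrite /above /nneg; move: cle; lia.
- move=> x /[dup] /s0 + /cs; rewrite /attacks /step /above /nneg => *.
  by split; lia.
Qed.

Lemma sum_words s : pairwise above s ->
  \sum_(w <- permutations s) W w
  = \prod_(c <- s) qint q
     (if nneg c then count (fun x => [&& nneg x, above c x & step x c]) s + npos c
      else count (fun x => above x c && step c x) s).
Proof.
move=> ps; pose U := filter nneg s; pose L := filter (predC nneg) s.
have pUL : perm_eq (U ++ L) s by rewrite perm_filterC.
have pU : pairwise above U by rewrite pairwise_filter.
have pL : pairwise above L by rewrite pairwise_filter.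
have U0 : all nneg U by rewrite filter_all.
have L0 : all (predC nneg) L by rewrite filter_all.
have -> : \sum_(w <- permutations s) W w
  = (\prod_(c <- L) qint q (count (fun x => above x c && step c x) (U ++ L)))
    * \sum_(w <- permutations U) W w.
  (* The head of a list is the letter inserted last, so the order [rev L ++ U] inserts [U] first and
     then [L] from left to right. *)
  rewrite -(perm_big _ (perm_permutations (_ : perm_eq (rev L ++ U) s))); last first.
    by rewrite perm_catC -(permPr pUL) perm_cat2l perm_rev.
  have uUL : uniq (U ++ L) by rewrite (perm_uniq pUL) above_uniq.
  elim/last_ind: {pUL} L pL L0 uUL => [|L c IHL] pL L0 uUL.
    by rewrite big_nil mul1r.
  rewrite rev_rcons cat_cons /W.
  move: pL L0; rewrite -cats1 pairwise_cat all_cat allrel1r /= !andbT.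
  move=> /andP[/allP Lc pL] /andP[/[dup] L0 /allP L0' c0].
  have {}IHL := IHL pL L0.
  have abvc x : x \in L -> above c x = false.
    by move=> /Lc; rewrite /above; lia.
  rewrite (@sum_permutations_cons _ _ _ _ _ q npos true c _
    (count (fun x => above x c && step c x) (U ++ (L ++ [:: c])))).
  - rewrite -/W IHL; last by move: uUL; rewrite -cats1 catA cat_uniq => /andP[].
    rewrite mulrA; congr (_ * _); rewrite big_cat big_seq1 mulrC; congr (_ * _).
    apply: eq_big_seq => x xL; congr qint.
    by rewrite catA [RHS]count_cat /= abvc //= !addn0.
  - rewrite -(perm_uniq (_ : perm_eq (U ++ rcons L c) _)) //.
    rewrite -cats1 catA perm_sym -cat1s perm_catC perm_cat2r.
    by rewrite perm_catC perm_cat2l perm_rev.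
  move=> v pv.
  have v_cases x : x \in v -> x \in U \/ x \in L.
    by rewrite (perm_mem pv) mem_cat mem_rev => /orP[]; [right|left].
  have vc x : x \in v -> above x c.
    move=> /v_cases[|/Lc //]; rewrite mem_filter => /andP[+ _].
    by move: c0; rewrite /nneg /above; lia.
  rewrite sum_ins_before //.
  - congr (_ * qint q _); rewrite (negbTE c0) addn0 catA [RHS]count_cat /=.
    rewrite above_irr !addn0 (seq.permP pv) [LHS]count_cat count_rev addnC -count_cat.
    apply: eq_in_count => x xUL; rewrite vc //.
    by rewrite (perm_mem pv) mem_cat mem_rev orbC -mem_cat.
  - by move=> x /vc; rewrite /above /step; lia.
  - by move: c0; rewrite /nneg /npos; lia.
  - move=> x xv cx; have xc := vc x xv.
    split=> [|y /vc]; move: c0 cx xc; rewrite /nneg /npos /step /above; lia.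
  - by rewrite (negbTE c0).
  - by move=> x /vc; rewrite /attacks /step /above => *; split; lia.
rewrite sum_words_nneg // -(perm_big _ pUL) big_cat mulrC /=; congr (_ * _).
  apply: eq_big_seq => x; rewrite mem_filter => /andP[-> _].
  by congr (qint q (_ + _)); rewrite count_filter; apply: eq_count => y; rewrite andbC.
apply: eq_big_seq => x; rewrite mem_filter => /andP[/negbTE-> _].
by rewrite (seq.permP pUL).
Qed.
End Words.

(** * Preference functions as words *)

Lemma sorted_index (T : eqType) (r : rel T) (w : seq T) c :
  transitive r -> irreflexive r -> sorted r w -> c \in w ->
  index c w = count (r^~ c) w.
Proof.
move=> tr ir; rewrite sorted_pairwise //; elim: w => // x w IHw /= /andP[/allP xw pw].
rewrite inE; case: eqP => [-> _|/eqP cx /= cw].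
  rewrite eqxx ir add0n; apply/esym/eqP; rewrite -leqn0 leqNgt -has_count.
  apply/hasPn => y /xw xy; apply/negP => yx.
  by have := tr _ _ _ xy yx; rewrite ir.
by rewrite eq_sym (negbTE cx) (IHw pw cw) xw.
Qed.

Lemma adm_path (T : eqType) (e : rel T) (lok P : pred T) E x w :
  adm e lok P E (x :: w) = [&& P x, path e x w & lok (last x w)].
Proof.
elim: w x P E => [|y w IHw] x P E //.
by rewrite -[LHS]/(P x && adm e lok (e x) (lok x) (y :: w)) IHw /= -andbA.
Qed.

(** In a word sorted by a strict order [r], one letter precedes another exactly when [r] relates
    them; positions thus disappear from the count. *)
Lemma ginv_pairs (T : eqType) (r g : rel T) w :
  irreflexive r -> transitive r -> pairwise r w ->
  ginv g w = \sum_(x <- w) count (fun y => r x y && g x y) w.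
Proof.
move=> ir tr; elim: w => [|c w IHw]; first by rewrite big_nil.
move=> /= /andP[/allP cw pw]; rewrite big_cons /= ir add0n IHw //; congr (_ + _).
  by apply: eq_in_count => y /cw ->.
apply: eq_big_seq => x /cw cx.
by case xc: (r x c) => //=; have := tr _ _ _ cx xc; rewrite ir.
Qed.

Section Reading.
Variables (n : nat) (f : prefn n).
Implicit Types (x y c : 'I_n) (w : seq 'I_n).

Definition flt x y := (f x < f y) || (f x == f y) && (x < y).
Definition fle x y := (f x < f y) || (f x == f y) && (x <= y).
Definition reading := sort fle (enum 'I_n).

Lemma flt_irr : irreflexive flt.
Proof. by move=> x; rewrite /flt !ltnn andbF. Qed.

Lemma flt_trans : transitive flt.
Proof. by move=> y x z; rewrite /flt -!val_eqE /=; lia. Qed.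

Lemma prowE c : prow f c = count (flt^~ c) (enum 'I_n).
Proof.
rewrite /prow -!sum1dep_card -sum1_count big_enum_cond /=.
rewrite [RHS](bigID (fun j => f j < f c)) /=; congr (_ + _); apply: eq_bigl => j.
  by rewrite /flt; lia.
by rewrite /flt -val_eqE /=; lia.
Qed.

Lemma prow_lt x y : flt x y -> prow f x < prow f y.
Proof.
move=> xy; rewrite !prowE -!size_filter.
have : uniq (x :: filter (flt^~ x) (enum 'I_n)).
  by rewrite /= mem_filter flt_irr filter_uniq // enum_uniq.
move=> /uniq_leq_size; apply => z; rewrite in_cons !mem_filter -!enumT !mem_enum /= !andbT.
by case/predU1P => [->//|zx]; apply: flt_trans zx xy.
Qed.

Lemma perm_reading : perm_eq reading (enum 'I_n).
Proof. by rewrite /reading perm_sort. Qed.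

Lemma reading_sorted : sorted flt reading.
Proof.
rewrite sorted_pairwise; last exact: flt_trans.
have : pairwise fle reading.
  rewrite -sorted_pairwise; last by move=> y x z; rewrite /fle -!val_eqE /=; lia.
  by apply: sort_sorted => x y; rewrite /fle -!val_eqE /=; lia.
have : pairwise [rel x y | x != y] reading.
  by rewrite -uniq_pairwise (perm_uniq perm_reading) enum_uniq.
move=> /[swap] pf /(conj pf)/andP; rewrite -pairwise_relI.
by apply: sub_pairwise => x y /=; rewrite /fle /flt -!val_eqE /=; lia.
Qed.

Lemma sorted_reading w : perm_eq w (enum 'I_n) -> sorted flt w -> w = reading.
Proof.
move=> pw sw; apply: (irr_sorted_eq flt_trans flt_irr sw reading_sorted).
by move=> x; rewrite (perm_mem pw) (perm_mem perm_reading).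
Qed.

Lemma index_sorted_prow w c :
  perm_eq w (enum 'I_n) -> sorted flt w -> index c w = prow f c.
Proof.
move=> pw sw; rewrite prowE -(seq.permP pw); apply: sorted_index => //.
- exact: flt_trans.
- exact: flt_irr.
- by rewrite (perm_mem pw) mem_enum.
Qed.

Lemma nth_reading x0 i : i < n -> prow f (nth x0 reading i) = i.
Proof.
move=> ltin; rewrite -(index_sorted_prow _ perm_reading reading_sorted) index_uniq //.
  by rewrite (perm_size perm_reading) size_enum_ord.
by rewrite (perm_uniq perm_reading) enum_uniq.
Qed.

(** The first car is in row 0, hence on a diagonal <= 0; the last is in row n - 1 and a column <= n
    - 1, hence on a diagonal >= 0. One row up, the column does not decrease, so the diagonal gains
    at most 1, with equality within a column. *)
Lemma reading_adm D : pdiag f =1 D -> adm (step D) (nneg D) (npos D) true reading.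
Proof.
move=> DE.
have := nth_reading; have := reading_sorted.
have : size reading = n by rewrite (perm_size perm_reading) size_enum_ord.
case: reading => [//|x w]; rewrite adm_path /= => sn pw nthw.
have ltw i : i <= size w -> i < n by rewrite -ltnS sn.
have r0 : prow f x = 0 by rewrite -[RHS](nthw x) ?ltw.
have rl : prow f (last x w) = size w by rewrite (last_nth x) nthw ?ltw.
have fl := ltn_ord (f (last x w)).
rewrite /npos /nneg -!DE /pdiag r0 rl; apply/and3P; split; [lia| |lia].
apply/(pathP x) => i lti; have := pathP x pw i lti.
have := nthw x i (ltw _ (ltnW lti)); have := nthw x i.+1 (ltw _ lti).
by rewrite /= /step -!DE /pdiag => -> ->; rewrite /flt -!val_eqE /=; lia.
Qed.

Lemma card_pairs (P : rel 'I_n) :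
  #|[set p : 'I_n * 'I_n | P p.1 p.2]| = \sum_x \sum_y (P x y).
Proof.
rewrite -sum1dep_card pair_big /= big_mkcond /=.
by apply: eq_bigr => p _; case: (P _ _).
Qed.

Lemma ginv_reading D : pdiag f =1 D ->
  ginv (attacks D) reading = pdinv_primary f + pdinv_secondary f.
Proof.
move=> DE.
rewrite (@ginv_pairs _ flt _ _ flt_irr flt_trans) -?sorted_pairwise ?reading_sorted //; last first.
  exact: flt_trans.
rewrite /pdinv_primary /pdinv_secondary.
rewrite (card_pairs (fun x y => [&& pdiag f x == pdiag f y, f x < f y & x < y])).
rewrite (card_pairs (fun x y => [&& y < x, pdiag f x == (pdiag f y + 1)%R & f x < f y])).
rewrite (perm_big _ perm_reading) big_enum -big_split /=; apply: eq_bigr => x _.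
rewrite (seq.permP perm_reading) -sum1_count big_enum_cond big_mkcond -big_split /=.
apply: eq_bigr => y _; rewrite /attacks -!DE.
(* Of two cars in one column, the earlier is on a strictly lower diagonal, so it cannot attack the
   later one; reading order may be replaced by comparison of columns. *)
have := @prow_lt x y; rewrite -/(nat_of_bool _) /flt /pdiag -!val_eqE /=.
  by case: (ltngtP (f x) (f y)); case: (ltngtP x y) => /=; lia.
Qed.
End Reading.

Section WordBijection.
Variables (n : nat) (D : 'I_n -> int).
Implicit Types (x y c : 'I_n) (w : seq 'I_n).

Lemma adm_reading w : perm_eq w (enum 'I_n) ->
  adm (step D) (nneg D) (npos D) true w ->
  exists2 f : prefn n, pdiag f =1 D & reading f = w.
Proof.
(* A car in row [index c w] on diagonal [D c] must lie in column [h c]. Admissibility makes [h]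
   weakly increasing along [w], with increasing labels at ties, and the end conditions keep it
   between 0 and n - 1. *)
move=> pw admw; pose h c : int := ((index c w)%:Z - D c)%R.
have uw : uniq w by rewrite (perm_uniq pw) enum_uniq.
have sw : size w = n by rewrite (perm_size pw) size_enum_ord.
have inw c : c \in w by rewrite (perm_mem pw) mem_enum.
pose hlt x y := (h x < h y)%R || (h x == h y) && (x < y).
have [hw hn] : sorted hlt w /\ forall c, (0 <= h c < n%:Z)%R.
  case: w pw admw @h uw sw inw @hlt => [|x w] pw admw h uw sw inw hlt.
    by split=> // c; have := inw c; rewrite in_nil.
  move: admw; rewrite adm_path => /and3P[x0 pD lst].
  have pH : path hlt x w.
    apply/(pathP x) => i lti; have := pathP x pD i lti.
    rewrite /step /hlt /h (index_uniq x _ uw) ?(leqW lti) //.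
    by rewrite -[nth x w i]/(nth x (x :: w) i.+1) index_uniq //=; lia.
  split=> // c.
  have le_h i j : i <= j -> j < size (x :: w) ->
      (h (nth x (x :: w) i) <= h (nth x (x :: w) j))%R.
    move=> ij jw; have [ltij|ji] := ltnP i j; last by rewrite (_ : i = j) //; lia.
    have : transitive hlt by move=> a b d; rewrite /hlt; lia.
    move=> /(@sorted_ltn_nth _ hlt) /(_ x (x :: w) pH i j).
    rewrite !inE (leq_trans ltij (ltnW jw)) jw => /(_ isT isT ltij).
    by rewrite /hlt; lia.
  have lti : index c (x :: w) < size (x :: w) by rewrite index_mem.
  have := le_h 0 _ (leq0n _) lti; have := le_h (index c (x :: w)) (size w) lti (ltnSn _).
  have hx : h x = (- D x)%R by rewrite /h /= eqxx; lia.
  have hl : h (last x w) = ((size w)%:Z - D (last x w))%R.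
    by rewrite /h index_last //.
  rewrite nth_index // -last_nth -[nth x (x :: w) 0]/x hx hl.
  by move: x0 lst sw; rewrite /npos /nneg /=; lia.
pose f : prefn n := [ffun c => insubd c `|h c|%N].
have fE c : Posz (f c) = h c.
  by have := hn c; rewrite /f ffunE val_insubd; case: ifP => /=; lia.
have fw : sorted (flt f) w.
  by apply: sub_sorted hw => x y; rewrite /hlt /flt -!fE -!val_eqE /=; lia.
exists f; last by rewrite -(sorted_reading pw fw).
by move=> c; rewrite /pdiag -(index_sorted_prow c pw fw) fE /h; lia.
Qed.

Lemma reading_inj (f f' : prefn n) :
  pdiag f =1 pdiag f' -> reading f = reading f' -> f = f'.
Proof.
move=> ed er; apply/ffunP => c; apply: val_inj => /=.
have := ed c; rewrite /pdiag -(index_sorted_prow c (perm_reading f)) ?reading_sorted //.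
by rewrite -(index_sorted_prow c (perm_reading f')) ?reading_sorted // er; lia.
Qed.

Lemma perm_readings :
  perm_eq [seq reading f | f <- enum {: prefn n} & [forall c, pdiag f c == D c]]
          (filter (adm (step D) (nneg D) (npos D) true) (permutations (enum 'I_n))).
Proof.
have PE (f : prefn n) : reflect (pdiag f =1 D) [forall c, pdiag f c == D c].
  by apply: (iffP forallP) => H c; apply/eqP/H.
apply: uniq_perm; last 1 first.
- move=> w; rewrite mem_filter mem_permutations.
  apply/mapP/andP => [[f] + ->|[aw pw]].
    rewrite mem_filter => /andP[/PE df _].
    by rewrite reading_adm // perm_reading.
  have [f df <-] := adm_reading pw aw.
  by exists f; rewrite // mem_filter mem_enum andbT; apply/PE.
- rewrite map_inj_in_uniq; first by apply: filter_uniq; apply: enum_uniq.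
  move=> f f'.
  rewrite !mem_filter => /andP[/PE df _] /andP[/PE df' _].
  by apply: reading_inj => c; rewrite df df'.
- by rewrite filter_uniq ?permutations_uniq.
Qed.

Lemma sum_pref (R : comNzRingType) (q : R) :
  (\sum_(f : prefn n | [forall c, pdiag f c == D c])
      q ^+ (pdinv_primary f + pdinv_secondary f)
   = \sum_(w <- permutations (enum 'I_n))
      wt (step D) (attacks D) (nneg D) q (npos D) true w)%R.
Proof.
transitivity (\sum_(w <- permutations (enum 'I_n) |
    adm (step D) (nneg D) (npos D) true w) q ^+ ginv (attacks D) w)%R.
  rewrite -[RHS]big_filter -(perm_big _ perm_readings) big_map big_filter big_enum_cond /=.
  apply: eq_big => [f|f /forallP df] //.
  by rewrite (@ginv_reading _ _ D) // => c; apply/eqP.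
rewrite big_mkcond /=; apply: eq_bigr => w _; rewrite /wt.
by case: adm; rewrite ?mul0r ?mul1r.
Qed.
End WordBijection.

(** * Runs of a permutation *)

Section Levels.
Implicit Types (s r : seq nat) (x y c : nat).

(** This is the [j] of [sched]; for the cars it will be the diagonal shifted by [l]. *)
Definition level s c := find (fun r => c \in r) (rev (runs s)).

Lemma runs_cons x s : exists r rs, runs (x :: s) = (x :: r) :: rs.
Proof.
rewrite /=; case: (runs s) => [|[|y r] rs]; first by exists [::], [::].
  by exists [::], [::].
by case: ifP; [exists (y :: r), rs|exists [::], ((y :: r) :: rs)].
Qed.

Lemma runs_cons2 x y s : runs [:: x, y & s]
  = if x < y then (x :: head [::] (runs (y :: s))) :: behead (runs (y :: s))
    else [:: x] :: runs (y :: s).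
Proof.
have [r [rs E]] := runs_cons y s.
by rewrite -[runs [:: x, y & s]]/(match runs (y :: s) with
  | (z :: u) :: us => if x < z then (x :: z :: u) :: us else [:: x] :: (z :: u) :: us
  | _ => [:: [:: x]] end) E.
Qed.

Lemma flatten_runs s : flatten (runs s) = s.
Proof.
elim: s => // x [//|y s]; have [r [rs]] := runs_cons y s.
by rewrite runs_cons2 => -> /= <-; case: ifP.
Qed.

Lemma has_runs s c : has (fun r => c \in r) (rev (runs s)) = (c \in s).
Proof.
rewrite has_rev -{2}(flatten_runs s); elim: (runs s) => //= r rs ->.
by rewrite mem_cat.
Qed.

(** Numbering the runs from the end makes the level insensitive to letters added in front, which
    allows induction on the word. *)
Lemma level_cons x s c : uniq (x :: s) -> c \in s -> level (x :: s) c = level s c.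
Proof.
case: s => // y s /= /andP[xs _] cs.
have cx : (c == x) = false by apply: contraNF xs => /eqP <-.
have := has_runs (y :: s) c; rewrite cs /level runs_cons2.
have [r [rs ->]] := runs_cons y s.
case: ifP => _ hc; rewrite !rev_cons -!cats1 in hc *.
  by rewrite !find_cat /= !inE cx.
by rewrite find_cat hc.
Qed.

Lemma level_head_size x s : uniq (x :: s) -> (level (x :: s) x).+1 = size (runs (x :: s)).
Proof.
have := flatten_runs (x :: s); rewrite /level.
have [r [rs ->]] := runs_cons x s; case=> Es /= /andP[xs _].
rewrite rev_cons -cats1 find_cat /= mem_head addn0 size_rev.
case: ifP => // /hasP[u]; rewrite mem_rev => uin xu.
by case/negP: xs; rewrite -Es mem_cat; apply/orP; right; apply/flattenP; exists u.
Qed.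

Lemma level_head x y s : uniq (x :: y :: s) ->
  level [:: x, y & s] x = level (y :: s) y + (y < x).
Proof.
move=> us; have /andP[xs uys] := us.
apply: succn_inj; rewrite -addSn !level_head_size // runs_cons2.
have [r [rs ->]] := runs_cons y s; case: ltngtP => [||exy] /=; rewrite ?addn0 ?addn1 //.
by rewrite exy mem_head in xs.
Qed.

Lemma level_last x s : uniq (x :: s) -> level (x :: s) (last x s) = 0.
Proof.
elim: s x => [|y s IHs] x us; first by rewrite /level /= inE eqxx.
have uys : uniq (y :: s) by case/andP: us.
by rewrite -[last x _]/(last y s) level_cons ?mem_last // IHs.
Qed.

Lemma level_adjacent s : uniq s ->
  sorted (fun x y => level s x == level s y + (y < x)) s.
Proof.
elim: s => // x [|y s] IHs us //.
rewrite -[sorted _ _]/((level [:: x, y & s] x == level [:: x, y & s] y + (y < x)) &&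
  sorted (fun u v => level [:: x, y & s] u == level [:: x, y & s] v + (v < u)) (y :: s)).
have uys : uniq (y :: s) by case/andP: us.
have -> : level [:: x, y & s] y = level (y :: s) y by rewrite level_cons ?mem_head.
rewrite level_head // eqxx [sorted _ _]/=.
rewrite (@eq_in_path _ (mem (y :: s)) _
   (fun u v => level (y :: s) u == level (y :: s) v + (v < u))).
- exact: IHs.
- by move=> u v us' vs'; rewrite !(level_cons us).
by apply/allP.
Qed.

Lemma rrun_level s j : uniq s -> rrun s j = [seq x <- s | level s x == j].
Proof.
elim: s j => [|x [|y s] IHs] j us.
- by rewrite /rrun /= nth_nil.
- by rewrite /rrun /level /= inE eqxx; case: j => [|j] //=; rewrite nth_nil.
have uys : uniq (y :: s) by case/andP: us.
have -> : [seq z <- [:: x, y & s] | level [:: x, y & s] z == j]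
  = if level [:: x, y & s] x == j then x :: rrun (y :: s) j else rrun (y :: s) j.
  rewrite IHs // -[LHS]/(if level [:: x, y & s] x == j then
    x :: [seq z <- y :: s | level [:: x, y & s] z == j]
    else [seq z <- y :: s | level [:: x, y & s] z == j]).
  by congr (if _ then (_ :: _) else _);
     apply: eq_in_filter => z zs; rewrite level_cons.
have := level_head_size uys; rewrite level_head // /rrun runs_cons2.
have [r [rs ->]] := runs_cons y s; case=> ->.
have yx : (y < x) = ~~ (x < y).
  by case/andP: us; case: ltngtP => // ->; rewrite mem_head.
rewrite yx; case: ifP => _ /=; rewrite !rev_cons !nth_rcons ?size_rcons ?size_rev.
  by rewrite addn0; case: (ltngtP j).
by rewrite addn1; do !case: ifP => //; lia.
Qed.

Lemma level_descents x s : uniq (x :: s) ->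
  level (x :: s) x = \sum_(0 <= i < size s) (nth 0 s i < nth 0 (x :: s) i).
Proof.
elim: s x => [|y s IHs] x us; first by rewrite big_geq // /level /= inE eqxx.
rewrite level_head // IHs; last by case/andP: us.
by rewrite [RHS]big_nat_recl // addnC.
Qed.

(** A letter put in front shifts every descent by one position and may create one at position 1, so
    [maj] grows by the number of descents of [x :: s], which is the level of its head. *)
Lemma maj_cons x s : uniq (x :: s) -> maj (x :: s) = maj s + level (x :: s) x.
Proof.
move=> us; rewrite level_descents // /maj big_mkcond [in RHS]big_mkcond /=.
case: s us => [|y s] us /=; first by rewrite !big_geq.
rewrite !big_nat_recl //= addnCA -big_split /=; congr (_ + _).
by apply: eq_bigr => i _; case: ifP => _; rewrite /= ?addn1.
Qed.

Lemma maj_level s : uniq s -> maj s = \sum_(x <- s) level s x.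
Proof.
elim: s => [|x s IHs] us; first by rewrite /maj big_nil big_geq.
have us' : uniq s by case/andP: us.
rewrite maj_cons // big_cons IHs // addnC; congr (_ + _).
by apply: eq_big_seq => z zs; rewrite level_cons.
Qed.
End Levels.

(** * The diagonal word *)

(** A discrete intermediate value argument: the pair is the first step of the path that passes above
    [k]. The next lemma takes the first such step after [z]. *)
Lemma path_cross_up (T : eqType) (e : rel T) (d : T -> int) (k : int) x w z :
  path e x w -> (d x <= k)%R -> z \in w -> (k < d z)%R ->
  exists p q, [/\ e p q, (d p <= k)%R & (k < d q)%R].
Proof.
elim: w x => // y w IHw x /= /andP[xy pw] dx + dz.
have [dy|dy _] := lerP (d y) k; last by exists x, y.
rewrite inE; case: eqP => [zy|_ /= zw]; last exact: IHw pw dy zw dz.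
by move: dz; rewrite zy; lia.
Qed.

Lemma path_cross_last (T : eqType) (e : rel T) (d : T -> int) (k : int) x w z :
  path e x w -> z \in x :: w -> (d z <= k)%R -> (k < d (last x w))%R ->
  exists p q, [/\ e p q, (d p <= k)%R & (k < d q)%R].
Proof.
elim: w x z => [|y w IHw] x z /=.
  by rewrite inE => _ /eqP ->; lia.
move=> /andP[xy pw] + dz dl.
rewrite inE; case: eqP => [zx _|_ /= zw]; last exact: IHw pw zw dz dl.
have [dy|dy] := lerP (d y) k; first by apply: IHw pw _ dy dl; rewrite mem_head.
by exists x, y; split => //; rewrite -zx.
Qed.

Lemma eq_from_last (T : eqType) (F G : T -> int) (x : T) (w : seq T) :
  path (fun y z => F y - F z == G y - G z)%R x w ->
  F (last x w) = G (last x w) -> {in x :: w, F =1 G}.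
Proof.
elim: w x => [|y w IHw] x /=; first by move=> _ E z; rewrite inE => /eqP ->.
move=> /andP[/eqP xy pw] /(IHw _ pw) E z; rewrite inE => /predU1P[->|]; last exact: E.
by have := E y (mem_head _ _); lia.
Qed.

Lemma descents_above n (D : 'I_n -> int) (s : seq 'I_n) : uniq s ->
  sorted (fun y z => D y - D z == (z < y)%:Z)%R s -> pairwise (above D) s.
Proof.
move=> us sD; rewrite -sorted_pairwise; last exact: above_trans.
case: s us sD => // x s us pD.
apply/(pathP x) => i lti; have := pathP x pD i lti; rewrite /above.
have : nth x (x :: s) i != nth x (x :: s) i.+1.
  by rewrite nth_uniq //= ?ltnS ?(ltnW lti) //; lia.
by rewrite -val_eqE /=; lia.
Qed.

Section DiagonalWord.
Variables (n : nat) (f : prefn n).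
Implicit Types (x y c : 'I_n) (s : seq 'I_n).

Lemma pairwise_ltn_enum : pairwise (fun x y => x < y) (enum 'I_n).
Proof.
rewrite -(pairwise_map val ltn) val_enum_ord -sorted_pairwise ?iota_ltn_sorted //.
exact: ltn_trans.
Qed.

Lemma pdiagword_above : pairwise (above (pdiag f)) (pdiagword f).
Proof.
rewrite /pdiagword; set ks := map _ (iota _ _).
have : pairwise (fun i j : int => j < i)%R ks.
  rewrite /ks pairwise_map; have := iota_ltn_sorted 0 (2 * n - 1).
  rewrite (sorted_pairwise ltn_trans).
  by apply: sub_pairwise => i j /=; lia.
elim: ks => //= k ks IHks /andP[/allP kks pks].
rewrite pairwise_cat IHks // andbT; apply/andP; split.
  apply/allrelP => x y; rewrite mem_filter => /andP[/eqP xk _].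
  move=> /flattenP[r /mapP[j /kks jk ->]]; rewrite mem_filter => /andP[/eqP yj _].
  by rewrite /above xk yj jk.
have H : pairwise (fun x y => x < y) [seq c <- enum 'I_n | pdiag f c == k].
  exact: subseq_pairwise (filter_subseq _ _) pairwise_ltn_enum.
apply: (sub_in_pairwise _ (filter_all (fun c => pdiag f c == k) _) H) => x y.
by move=> /eqP kx /eqP ky xy; rewrite /above kx ky eqxx xy orbT.
Qed.

Lemma mem_pdiagword c : c \in pdiagword f.
Proof.
have ltp : prow f c < n.
  rewrite -(index_sorted_prow c (perm_reading f) (reading_sorted f)).
  rewrite -[X in _ < X](size_enum_ord n) -(perm_size (perm_reading f)) index_mem.
  by rewrite (perm_mem (perm_reading f)) mem_enum.
have ltf := ltn_ord (f c).
apply/flattenP; exists [seq c' <- enum 'I_n | pdiag f c' == pdiag f c].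
  apply/mapP; exists (pdiag f c) => //; apply/mapP.
  exists (n.-1 + f c - prow f c); last by rewrite /pdiag; lia.
  by rewrite mem_iota; lia.
by rewrite mem_filter eqxx mem_enum.
Qed.

Lemma pdiagwordE s : perm_eq s (enum 'I_n) -> pairwise (above (pdiag f)) s ->
  pdiagword f = s.
Proof.
move=> ps; rewrite -sorted_pairwise; last exact: above_trans.
have := pdiagword_above; rewrite -sorted_pairwise; last exact: above_trans.
move=> sd ss; apply: (irr_sorted_eq (@above_trans _ _) (@above_irr _ _) sd ss) => c.
by rewrite mem_pdiagword (perm_mem ps) mem_enum.
Qed.

(** If [x] is on a higher diagonal than [y], some step from [p] to [q] of the reading word leaves
    the diagonals up to that of [y]. It climbs by at most 1 and no car lies between [x] and [y], so
    [p] is on the diagonal of [y], [q] on that of [x], and these are consecutive. Moreover y <= p <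
    q <= x as labels, so [y < x]. *)
Lemma diag_descent x y :
  (forall z, [\/ z = x, z = y, above (pdiag f) z x | above (pdiag f) y z]) ->
  above (pdiag f) x y -> pdiag f x = (pdiag f y + (y < x)%:Z)%R.
Proof.
move=> adj /orP[ltD|/andP[/eqP -> ltxy]]; last by rewrite ltnNge ltnW ?addr0.
have [p [q [pq dp dq]]] : exists p q,
    [/\ step (pdiag f) p q, (pdiag f p <= pdiag f y)%R & (pdiag f y < pdiag f q)%R].
  have := reading_adm (frefl (pdiag f)).
  have inr z : z \in reading f by rewrite (perm_mem (perm_reading f)) mem_enum.
  case: (reading f) inr => [/(_ x)|u w inr]; first by rewrite in_nil.
  rewrite adm_path => /and3P[du pw dl].
  (* If [y] has a negative diagonal, the crossing occurs between [y] and the last car, whose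
     diagonal is >= 0; otherwise between the first car, whose diagonal is <= 0, and [x]. *)
  have [y0|y0] := ltrP (pdiag f y) 0%R.
    apply: (path_cross_last pw (inr y) (lexx _)).
    exact: lt_le_trans dl.
  apply: (@path_cross_up _ _ (pdiag f) _ _ _ x pw) => //.
    exact: le_trans y0.
  have := inr x; rewrite inE => /predU1P[xu|//].
  by move: du; rewrite /npos -xu; lia.
move: pq; rewrite /step; unfold above in adj.
by case: (adj p) (adj q) => [ep|ep|ap|ap] [eq|eq|aq|aq]; rewrite ?ep ?eq in dp dq *; lia.
Qed.

(** The differences of diagonals along the diagonal word are dictated by its descents, and the last
    car of that word has the least diagonal, minus the deviation; together these determine all
    diagonals. *)
Lemma pdiagword_pdevP s (D : 'I_n -> int) (l : nat) x :
  perm_eq (x :: s) (enum 'I_n) ->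
  path (fun y z => D y - D z == (z < y)%:Z)%R x s -> D (last x s) = (- l%:Z)%R ->
  (pdiagword f == x :: s) && (pdev f == l) = [forall c, pdiag f c == D c].
Proof.
move=> ps pD Dl.
have us : uniq (x :: s) by rewrite (perm_uniq ps) enum_uniq.
have ins c : c \in x :: s by rewrite (perm_mem ps) mem_enum.
have last_min : pairwise (above (pdiag f)) (x :: s) ->
    forall c, (pdiag f (last x s) <= pdiag f c)%R.
  rewrite lastI pairwise_rcons => /andP[/allP H _] c.
  have := ins c; rewrite lastI mem_rcons inE => /predU1P[->//|/H].
  by rewrite /above; lia.
apply/andP/forallP => [[/eqP fs /eqP fl] c|fD].
- have pw : pairwise (above (pdiag f)) (x :: s) by rewrite -fs pdiagword_above.
  apply/eqP; move: c (ins c); apply: eq_from_last; last first.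
    rewrite Dl; have minl := last_min pw.
    have I0 : 0 < #|'I_n| by apply/card_gt0P; exists x.
    have [z zl] : {z : 'I_n | pdev f = f z - prow f z} := bigop.eq_bigmax _ I0.
    (* The subtraction in [pdev] is truncated at 0; a car on a diagonal <= 0, the first of the
       reading word, shows that the truncation does not alter the maximum. *)
    have [u u0] : exists u, (pdiag f u <= 0)%R.
      have := reading_adm (frefl (pdiag f)).
      have : x \in reading f by rewrite (perm_mem (perm_reading f)) mem_enum.
      by case: (reading f) => [//|u w _] /= /andP[u0 _]; exists u.
    have maxl : f (last x s) - prow f (last x s) <= f z - prow f z.
      by rewrite -zl; apply: leq_bigmax.
    rewrite -fl zl; move: (last x s) (minl z) (minl u) u0 maxl => y.
    by rewrite /pdiag; lia.
  apply/(pathP x) => i lti; have := pathP x pD i lti => /eqP ->.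
  have lti' : i < size (x :: s) by apply: leqW.
  have ss : sorted (above (pdiag f)) (x :: s).
    by rewrite sorted_pairwise //; apply: above_trans.
  have lth := sorted_ltn_nth (@above_trans _ (pdiag f)) x ss.
  rewrite subr_eq addrC; apply/eqP; apply: diag_descent; last exact: lth (ltnSn i).
  move=> z; have zs : index z (x :: s) < size (x :: s) by rewrite index_mem.
  rewrite -(nth_index x (ins z)).
  case: (ltngtP (index z (x :: s)) i) => [zi|iz|->]; last by apply: Or41.
    by apply: Or43; apply: lth.
  move: iz; rewrite leq_eqVlt => /predU1P[<-|iz]; first by apply: Or42.
  by apply: Or44; apply: (lth i.+1).
have fD' c : pdiag f c = D c by apply/eqP.
have pw : pairwise (above (pdiag f)) (x :: s).
  by apply: sub_pairwise (descents_above us pD) => y z; rewrite /above !fD'.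
split; first by apply/eqP/pdiagwordE.
rewrite eqn_leq; apply/andP; split.
  apply/bigmax_leqP => c _; have := last_min pw c.
  by rewrite !fD' Dl -fD' /pdiag; lia.
apply: leq_trans (leq_bigmax (last x s)).
by have := fD' (last x s); rewrite Dl /pdiag; lia.
Qed.
End DiagonalWord.

(** * Schedule numbers *)

Lemma count_add (T : eqType) (a b c : pred T) s :
  {in s, forall x, a x + b x = c x :> nat} -> count a s + count b s = count c s.
Proof.
elim: s => //= x s IHs abc; rewrite addnACA abc ?mem_head // IHs // => y ys.
by apply: abc; rewrite inE ys orbT.
Qed.

Lemma sum_rho s l : uniq s -> \sum_(j < l) rho s j = count (fun c => level s c < l) s.
Proof.
move=> us; elim: l => [|l IHl]; first by rewrite big_ord0 (eq_count (a2 := pred0)) ?count_pred0.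
rewrite big_ord_recr /= IHl /rho rrun_level // size_filter.
by apply: count_add => x _; lia.
Qed.

Section Schedule.
Variables (n l : nat) (t : seq 'I_n).
Let s := map val t.
Let D (c : 'I_n) := ((level s c)%:Z - l%:Z)%R.
Hypotheses (ut : uniq t) (pt : pairwise (above D) t).

(** A run is a diagonal, so both sides count the same cars of the run of [c] and of a neighbouring
    run. On diagonal 0, the cars below are not yet inserted, and the front place stands for [c]
    itself. *)
Lemma sched_count c : c \in t -> sched l s c =
  if nneg D c then count (fun x => [&& nneg D x, above D c x & step D x c]) t + npos D c
  else count (fun x => above D x c && step D c x) t.
Proof.
move=> ct; have us : uniq s by rewrite map_inj_uniq //; apply: val_inj.
rewrite /sched -/(level s c) !rrun_level // !count_filter size_filter.
case: ltngtP => lc.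
- have -> : nneg D c = false by rewrite /nneg /D; lia.
  rewrite !count_map; apply: count_add => x xt /=.
  by rewrite /above /step /D; lia.
- have -> : nneg D c by rewrite /nneg /D; lia.
  have -> : npos D c = false by rewrite /npos /D; lia.
  rewrite !count_map addn0; apply: count_add => x xt /=.
  by rewrite /nneg /above /step /D; lia.
have -> : nneg D c by rewrite /nneg /D; lia.
have -> : npos D c by rewrite /npos /D; lia.
(* The run is increasing, so the index of [c] counts its smaller elements; removing them leaves [c]
   and the larger ones. *)
rewrite lc (@sorted_index _ ltn) //; first last.
- by rewrite mem_filter lc eqxx map_f.
- rewrite sorted_pairwise; last exact: ltn_trans.
  rewrite filter_map pairwise_map.
  have pl := subseq_pairwise (filter_subseq (fun x : 'I_n => level s x == l) t) pt.
  apply: (sub_in_pairwise _ (filter_all (fun x : 'I_n => level s x == l) t) pl).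
  move=> x y /eqP xl /eqP yl.
  by rewrite /above /D /= xl yl; lia.
- by move=> x; rewrite /= ltnn.
- exact: ltn_trans.
rewrite count_filter !count_map.
have cc : count (pred1 c) t = 1 by rewrite count_uniq_mem // ct.
pose gt_c (x : 'I_n) := (c < x) && (level s x == l).
have -> : count (preim val (fun x => level s x == l)) t
  = count (preim val (fun x => (x < c) && (level s x == l))) t + (count gt_c t + 1).
  rewrite -cc (@count_add _ _ _ (fun x => gt_c x || (x == c))) => [|x _]; last first.
    by rewrite /gt_c /= -val_eqE /=; lia.
  rewrite (@count_add _ _ _ (fun x : 'I_n => level s x == l)) // => x _ /=.
  rewrite /gt_c; have [->|] := eqVneq x c; first by rewrite ltnn lc eqxx.
  by rewrite -val_eqE /=; lia.
rewrite addKn; congr (_ + _); apply: eq_count => x.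
by rewrite /gt_c /nneg /above /step /D; lia.
Qed.
End Schedule.

(** * The permutation as a diagonal word, and the product formula *)

Section WordLevels.
Variables (n l : nat) (tau : 'S_n).
Let t := [seq tau i | i <- enum 'I_n].
Let D (c : 'I_n) := ((level (pword tau) c)%:Z - l%:Z)%R.

Lemma map_val_word : map val t = pword tau.
Proof. by rewrite /t -map_comp. Qed.

Lemma perm_word : perm_eq t (enum 'I_n).
Proof.
apply: uniq_perm; rewrite ?enum_uniq ?(map_inj_uniq perm_inj) ?enum_uniq // => c.
rewrite mem_enum -[c](permKV tau) map_f //; by rewrite mem_enum.
Qed.

Lemma uniq_word : uniq (pword tau).
Proof. by rewrite -map_val_word map_inj_uniq ?(perm_uniq perm_word) ?enum_uniq //; apply: val_inj. Qed.

Lemma word_descents : sorted (fun x y => D x - D y == (y < x)%:Z)%R t.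
Proof.
have := level_adjacent uniq_word; rewrite -{3}map_val_word sorted_map.
by apply: sub_sorted => x y /=; rewrite /D; lia.
Qed.

(** As [n] is positive, the word has a last letter; its level is 0, so [D] takes there the value
    -l. *)
Lemma diagword_dev (f : prefn n) : 1 <= n ->
  (map val (pdiagword f) == pword tau) && (pdev f == l) = [forall c, pdiag f c == D c].
Proof.
move=> n_gt0; rewrite -map_val_word (inj_eq (inj_map val_inj)).
have := perm_size perm_word; rewrite size_enum_ord.
case tE : t perm_word word_descents => [|x s] pxs dxs szt; first by move: szt => /=; lia.
apply: pdiagword_pdevP => //.
have := @level_last x (map val s); rewrite -map_cons -tE map_val_word uniq_word => /(_ isT).
by rewrite last_map /D => ->; lia.
Qed.

Lemma word_above : pairwise (above D) t.
Proof.
by apply: descents_above word_descents; rewrite (perm_uniq perm_word) enum_uniq.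
Qed.

Lemma parea_level (f : prefn n) : pdiag f =1 D -> pdev f = l -> parea f = maj (pword tau).
Proof.
move=> fD fl; transitivity (\sum_(x <- map val t) level (pword tau) x).
  rewrite big_map (perm_big _ perm_word) big_enum /=.
  by apply: eq_bigr => c _; have := fD c; rewrite fl /pdiag /D; lia.
by rewrite map_val_word maj_level ?uniq_word.
Qed.

Lemma tertiary_rho (f : prefn n) : pdiag f =1 D ->
  pdinv_tertiary f = \sum_(j < l) rho (pword tau) j.
Proof.
move=> fD; rewrite sum_rho ?uniq_word //.
have -> P : count P (pword tau) = count (P \o val) (enum 'I_n).
  by rewrite -map_val_word count_map; apply/seq.permP/perm_word.
rewrite /pdinv_tertiary -sum1dep_card -sum1_count big_enum_cond /=.
by apply: eq_bigl => c; rewrite /= fD /D; lia.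
Qed.
End WordLevels.

Theorem theorem2p2 (R : comNzRingType) (t q : R) (n : nat) (tau : 'S_n) (l : nat) :
  (1 <= n)%N -> (l < size (runs (pword tau)))%N ->
  (\sum_(f : prefn n | (map val (pdiagword f) == pword tau) && (pdev f == l))
      t ^+ parea f * q ^+ pdinv f)%R
  = (t ^+ maj (pword tau) * q ^+ (\sum_(j < l) rho (pword tau) j)
      * \prod_(c < n) qint q (sched l (pword tau) c))%R.
Proof.
move=> n_gt0 _; pose D (c : 'I_n) := ((level (pword tau) c)%:Z - l%:Z)%R.
pose s := [seq tau i | i <- enum 'I_n].
(* Area and tertiary dinv are constant once the diagonals are fixed, which leaves only the primary
   and secondary dinv to be summed. *)
transitivity (\sum_(f : prefn n | [forall c, pdiag f c == D c])
    t ^+ maj (pword tau) * q ^+ (\sum_(j < l) rho (pword tau) j)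
    * q ^+ (pdinv_primary f + pdinv_secondary f))%R.
  apply: eq_big => [f|f]; first exact: diagword_dev.
  move=> /[dup]; rewrite {1}diagword_dev // => /forallP fD /andP[_ /eqP fl].
  have {}fD : pdiag f =1 D by move=> c; apply/eqP.
  rewrite (parea_level fD) // /pdinv (tertiary_rho fD) exprD; ring.
rewrite -big_distrr /=; congr (_ * _)%R.
rewrite sum_pref -(perm_big _ (perm_permutations (perm_word tau))).
rewrite sum_words; last exact: word_above.
rewrite (perm_big _ (perm_word tau)) big_enum /=; apply: eq_bigr => c _.
have cs : c \in s by rewrite (perm_mem (perm_word tau)) mem_enum.
have us : uniq s by rewrite (perm_uniq (perm_word tau)) enum_uniq.
rewrite -(map_val_word tau) (sched_count us _ cs) map_val_word //.
exact: word_above.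
Qed.
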